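(* Let $\Omega\subset\mathbb{R}^n$ be a bounded domain with smooth boundary, $a=a(x)$ a smooth positive function and $\gamma=\gamma(x)$ a smooth real symmetric positive definite $n\times n$ matrix valued function on $\overline\Omega$. Let $\varphi$ be a smooth real function on $\overline\Omega$ satisfying the eikonal equation $\gamma\nabla\varphi\cdot\nabla\varphi=a$. Given $N\ge1$, let $a_0,\dots,a_N$ be smooth functions on $\overline\Omega$ satisfying $$2\gamma\nabla\varphi\cdot\nabla a_0+(\nabla\cdot\gamma\nabla\varphi)a_0=0,$$ $$2\gamma\nabla\varphi\cdot\nabla a_{j+1}+(\nabla\cdot\gamma\nabla\varphi)a_{j+1}=-\nabla\cdot\gamma\nabla a_j,\quad j=0,\dots,N-1.$$ For $\tau>0$ let $w$ be the unique solution of $$\nabla\cdot\gamma\nabla w-\tau a w=0\ \text{ in }\Omega,\qquad w=e^{\sqrt{\tau}\varphi}\sum_{j=0}^N\frac{a_j}{(\sqrt{\tau})^j}\ \text{ on }\partial\Omega.$$ Then, as $\tau\to\infty$, $$\Big\|e^{-\sqrt{\tau}\varphi}w-\sum_{j=0}^{N-1}\frac{a_j}{(\sqrt{\tau})^j}\Big\|_{H^1(\Omega)}=O\Big(\frac{1}{(\sqrt{\tau})^N}\Big).$$ *)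

(* Defs.v *)
From HB Require Import structures.
From mathcomp Require Import all_boot all_order all_algebra.
From mathcomp Require Import all_classical all_reals all_analysis.
Set Implicit Arguments. Unset Strict Implicit. Unset Printing Implicit Defensive.
Import Order.TTheory GRing.Theory Num.Theory.
Import numFieldNormedType.Exports.
Local Open Scope classical_set_scope.
Local Open Scope ring_scope.

Section Defs.
Variables (R : realType) (n : nat).
Local Notation V := 'rV[R]_n.

Definition partial (i : 'I_n) (f : V -> R) : V -> R :=
  fun x => derive f x (delta_mx 0 i).

Definition iter_partial (s : seq 'I_n) (f : V -> R) : V -> R :=
  foldr partial f s.

Definition smooth (f : V -> R) : Prop :=
  forall (s : seq 'I_n) (x : V), differentiable (iter_partial s f) x.

Definition smooth_mx (g : V -> 'M[R]_n) : Prop :=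
  forall i j, smooth (fun x => g x i j).

Definition div_gamma_grad (g : V -> 'M[R]_n) (u : V -> R) : V -> R :=
  fun x => \sum_(i < n) partial i (fun y => \sum_(j < n) g y i j * partial j u y) x.

Definition gamma_dot (g : V -> 'M[R]_n) (u v : V -> R) : V -> R :=
  fun x => \sum_(i < n) \sum_(j < n) g x i j * partial j u x * partial i v x.

Definition boundary (O : set V) : set V := closure O `\` O.

Definition smooth_bounded_domain (O : set V) : Prop :=
  [/\ open O, connected O, O !=set0,
      (exists M : R, forall x, O x -> `|x| <= M) &
      forall p, boundary O p ->
        exists (U : set V) (rho : V -> R),
          [/\ open U, U p, smooth rho,
              (forall x, U x -> exists i, partial i rho x != 0) &
              forall x, U x -> (O x <-> rho x < 0)]].

End Defs.

(* Lebesgue integral over R^n of a nonnegative extended function,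
   computed as an iterated integral (Tonelli) *)
Fixpoint integral_Rn (R : realType) (n : nat) : ('rV[R]_n -> \bar R) -> \bar R :=
  match n with
  | 0 => fun F => F 0
  | k.+1 => fun F =>
      (\int[@lebesgue_measure R]_(t in [set: R])
          integral_Rn (fun y : 'rV[R]_k => F (row_mx (\row_(_ < 1) t) y)))%E
  end.

Definition H1_norm_sq (R : realType) (n : nat) (O : set 'rV[R]_n)
  (f : 'rV[R]_n -> R) : \bar R :=
  (integral_Rn (fun x => (\1_O x * f x ^+ 2)%:E) +
   \sum_(i < n) integral_Rn (fun x => (\1_O x * partial i f x ^+ 2)%:E))%E.

(* Main.v *)
(* Write s = sqrt tau and u = e^(- s phi) w - sum_(j <= N) a_j / s^j. Conjugating
   by e^(s phi), the eikonal and transport equations give, in Omega,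
     div(gamma grad u) + 2 s gamma grad phi . grad u + s div(gamma grad phi) u
       = - s^(-N) div(gamma grad a_N),
   with u = 0 on the boundary. Multiplying by u, the terms carrying s become the
   divergence of s u^2 gamma grad phi and integrate to zero, whence
     int gamma grad u . grad u = s^(-N) int div(gamma grad a_N) u.
   The Poincare inequality, obtained from int d_0 (x_0 u^2) = 0, and uniform
   ellipticity then bound the H^1 norm of u by O(s^(-N)), and the term a_N / s^N
   is of the same size. *)
Require Import Defs.
From HB Require Import structures.
From mathcomp Require Import all_boot all_order all_algebra.
From mathcomp Require Import all_classical all_reals all_analysis.
From mathcomp Require Import measurable_realfun ring lra.
Import Order.TTheory GRing.Theory Num.Theory.
Import numFieldNormedType.Exports.
Local Open Scope classical_set_scope.
Local Open Scope ring_scope.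

Set Implicit Arguments. Unset Strict Implicit. Unset Printing Implicit Defensive.

(** * Iterated integrals as integrals on a product space *)

(** The remainder subtracts all N+1 terms although the claim concerns N of them: these are exactly
    the boundary data, so [u] vanishes on the boundary, and a_N / s^N is put back in the final
    estimate. The obstacle is that the norm is an iterated integral over row vectors, which carry no
    measure: it is moved to a product of copies of the Lebesgue line. The divergence theorem then
    becomes one-dimensional calculus: the fields are smooth on the whole space and vanish on the
    boundary, so each partial derivative integrates to zero over Omega by itself, line by line. The
    estimates are made pointwise: on Omega the H^1 density of u + a_N / s^N is at most A times the
    divergence of the energy field, plus 8 d_0 (x_0 u^2), plus a constant times s^(-2N). Integrating
    leaves only the last term, so no integral has to be absorbed and no Cauchy-Schwarz inequality
    for integrals is used. *)

(* The product of two sigma-finite measures is not inferred to be sigma-finite;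
   this wrapper attaches the structure by hand. *)
Section as_sigma_finite.
Context d (T : measurableType d) (R : realType) (mu : {measure set T -> \bar R}).
Hypothesis sigma_finite_mu : sigma_finite setT mu.

Definition as_sigma_finite & sigma_finite setT mu : set T -> \bar R := mu.

HB.instance Definition _ := Measure.on (as_sigma_finite sigma_finite_mu).
HB.instance Definition _ := Measure_isSigmaFinite.Build _ _ _
  (as_sigma_finite sigma_finite_mu) sigma_finite_mu.

End as_sigma_finite.

Section IteratedIntegral.
Context {R : realType}.

(** The body repeats the row built in the successor case of [integral_Rn], so that induction on the
    dimension unfolds by conversion. *)
Definition row_cons {k : nat} (t : R) (y : 'rV[R]_k) : 'rV[R]_k.+1 :=
  row_mx (\row_(_ < 1) t) y.

Lemma row_cons0 k (t : R) (y : 'rV[R]_k) : row_cons t y 0 ord0 = t.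
Proof.
by rewrite mxE; case: splitP => // j _; rewrite mxE.
Qed.

Lemma row_consS k (t : R) (y : 'rV[R]_k) (i : 'I_k) :
  row_cons t y 0 (lift ord0 i) = y 0 i.
Proof.
rewrite mxE; case: splitP => [[[|//] ?] //|j /= [ij]].
by congr (y 0 _); exact/val_inj.
Qed.

Lemma line_coord n (x : 'rV[R]_n) (t : R) (i j : 'I_n) :
  (x + t *: delta_mx 0 i) 0 j = x 0 j + t * (j == i)%:R.
Proof. by rewrite !mxE. Qed.

Lemma row_cons_line0 k (t : R) (y : 'rV[R]_k) :
  row_cons t y = row_cons 0 y + t *: delta_mx 0 ord0.
Proof.
apply/rowP => i; rewrite line_coord; case: (unliftP ord0 i) => [j|] ->.
  by rewrite !row_consS /= mulr0 addr0.
by rewrite !row_cons0 eqxx mulr1 add0r.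
Qed.

Lemma row_cons_lineS k (s t : R) (y : 'rV[R]_k) (i : 'I_k) :
  row_cons s (y + t *: delta_mx 0 i) =
  row_cons s y + t *: delta_mx 0 (lift ord0 i).
Proof.
apply/rowP => j; rewrite line_coord; case: (unliftP ord0 j) => [j'|] ->.
  by rewrite !row_consS line_coord (inj_eq lift_inj).
by rewrite !row_cons0 /= mulr0 addr0.
Qed.

(** Stated by coordinates rather than by the norm: under [row_cons] such a cube splits into an
    interval times a cube of one dimension less. *)
Definition boxed {n : nat} (M : R) : set 'rV[R]_n := [set x | forall i, `|x 0 i| <= M].

(* ['rV[R]_n] carries no measurable structure: the iterated integral is realized
   as a genuine integral over some [T], read through the map [iso]. The last
   clause is Fubini's theorem along the [i]-th coordinate lines, in the only form
   needed for integrating by parts. *)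
Definition lebesgue_chart {n : nat} d (T : measurableType d)
    (mu : {sigma_finite_measure set T -> \bar R}) (iso : T -> 'rV[R]_n) :=
  [/\ forall i, measurable_fun setT (fun t => iso t 0 i),
      forall F : 'rV[R]_n -> \bar R, (forall x, 0 <= F x)%E ->
        measurable_fun setT (F \o iso) ->
        integral_Rn F = (\int[mu]_t F (iso t))%E,
      forall M, (mu (iso @^-1` boxed M) < +oo)%E &
      forall (i : 'I_n) (f : 'rV[R]_n -> R) (B M : R),
        measurable_fun setT (f \o iso) ->
        (forall x, `|f x| <= B) -> (forall x, ~ boxed M x -> f x = 0) ->
        (forall x, \int[@lebesgue_measure R]_t
           (f (x + t *: delta_mx 0 i))%:E = 0)%E ->
        (\int[mu]_t (f (iso t))%:E = 0)%E].

Lemma measurable_boxed n d (T : measurableType d) (iso : T -> 'rV[R]_n) M :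
  (forall i, measurable_fun setT (fun t => iso t 0 i)) ->
  measurable (iso @^-1` boxed M).
Proof.
move=> miso.
rewrite (_ : _ @^-1` _ = \bigcap_(i in [set: 'I_n])
   ((fun t => iso t 0 i) @^-1` `[-M, M])); last first.
  apply/seteqP; split=> [x /= H i _|x /= H i]; have:= H i;
    by rewrite /= in_itv /= -ler_norml // => h; apply: h.
apply: fin_bigcap_measurable => //.
by move=> i _; rewrite -[X in measurable X]setTI; apply: miso.
Qed.

Lemma bigcup_boxed n : \bigcup_k boxed k%:R = [set: 'rV[R]_n].
Proof.
apply/seteqP; split => // x _.
exists (Num.truncn (\sum_i `|x 0 i|)).+1 => // i.
apply: le_trans (ltW (truncnS_gt _)).
by rewrite (bigD1 i) //= lerDl sumr_ge0.
Qed.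

Lemma bounded_integrable n d (T : measurableType d)
    (mu : {measure set T -> \bar R}) (iso : T -> 'rV[R]_n)
    (f : 'rV[R]_n -> R) (B M : R) :
  (forall i, measurable_fun setT (fun t => iso t 0 i)) ->
  (mu (iso @^-1` boxed M) < +oo)%E ->
  measurable_fun setT (f \o iso) ->
  (forall x, `|f x| <= B) -> (forall x, ~ boxed M x -> f x = 0) ->
  mu.-integrable setT (EFin \o (f \o iso)).
Proof.
move=> miso finM mf fB f0.
have mb := measurable_boxed M miso.
apply: (@le_integrable _ _ _ mu setT measurableT _
   (fun t => (B * \1_(iso @^-1` boxed M) t)%:E)).
- exact/measurable_EFinP.
- move=> t _ /=; rewrite lee_fin indicE.
  case: (boolP (t \in _)); rewrite ?inE ?notin_setE /=.
    by rewrite mulr1 => _; apply: le_trans (fB _) (ler_norm _).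
  by move=> h; rewrite f0 // normr0.
- under [X in mu.-integrable _ X]funext do rewrite EFinM.
  apply: integrableZl => //.
  apply/integrableP; split; first exact/measurable_EFinP.
  under eq_integral do rewrite gee0_abs ?lee_fin //.
  by rewrite integral_indic // setIT.
Qed.

(** Induction on the dimension: a Dirac mass on a one-point space, since [integral_Rn] is then
    evaluation at 0, and next the product with Lebesgue measure. Sigma-finiteness of each product is
    what Tonelli needs at the following stage; the cubes of integer size exhaust the space and prove
    it. *)
Lemma exists_lebesgue_chart n : exists d (T : measurableType d)
  (mu : {sigma_finite_measure set T -> \bar R}) (iso : T -> 'rV[R]_n),
  lebesgue_chart mu iso.
Proof.
elim: n => [|n [d [T [mu [iso [miso Hint Hbox Hline]]]]]].
  exists default_measure_display, unit, (\d_tt), (fun=> 0); split => //.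
  - move=> F F0 mF /=; rewrite integral_dirac //.
    by rewrite diracT mul1e.
  - by move=> M /=; rewrite diracE ltry.
  - by move=> i; exfalso; case: i.
pose leb : {sigma_finite_measure set (measurableTypeR R) -> \bar R} :=
  @lebesgue_measure R.
pose iso' (z : measurableTypeR R * T) : 'rV[R]_n.+1 := row_cons z.1 (iso z.2).
have miso' i : measurable_fun setT (fun z => iso' z 0 i).
  rewrite /iso'; case: (unliftP ord0 i) => [j|] ->.
    under eq_fun do rewrite row_consS.
    apply: (measurableT_comp (miso j)); exact: measurable_snd.
  under eq_fun do rewrite row_cons0; exact: measurable_fst.
have Hbox' M : ((leb \x mu)%E (iso' @^-1` boxed M) < +oo)%E.
  rewrite (_ : iso' @^-1` boxed M = `[-M, M]%classic `*` (iso @^-1` boxed M)); last first.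
    apply/seteqP; split=> -[t y] /=.
      move=> H; split => /=.
        by have := H ord0; rewrite row_cons0 in_itv /= ler_norml.
      by move=> i; have := H (lift ord0 i); rewrite row_consS.
    rewrite in_itv /= -ler_norml => -[h1 h2] i.
    by case: (unliftP ord0 i) => [j|] ->; rewrite ?row_consS ?row_cons0.
  rewrite product_measure1E //; last exact: measurable_boxed.
  apply: lte_mul_pinfty => //.
  by rewrite ge0_fin_numE //= lebesgue_measure_itv /=; case: ifP => _; rewrite ltry.
have sf : sigma_finite setT (leb \x mu)%E.
  exists (fun k => iso' @^-1` boxed k%:R).
    by rewrite -preimage_bigcup bigcup_boxed.
  by move=> k; split; [exact: measurable_boxed|exact: Hbox'].
exists _, (measurableTypeR R * T)%type, (as_sigma_finite sf), iso'; split => //.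
- move=> F F0 mF /=.
  transitivity (\int[(leb \x mu)%E]_z (F \o iso') z)%E; last by [].
  rewrite (fubini_tonelli1 (F \o iso')) //; last by move=> z; apply: F0.
  apply: eq_integral => t _; rewrite Hint //.
  exact: (measurableT_comp mF (measurable_pair1 _)).
- move=> i f B M mf fB f0 H.
  change (\int[(leb \x mu)%E]_z (f (iso' z))%:E = 0)%E.
  have intf : (leb \x mu)%E.-integrable setT (EFin \o (f \o iso')).
    apply: (@bounded_integrable _ _ _ _ _ _ B M) => //; apply: (Hbox' M).
  (* The order of integration puts the line inside. Along the first axis the Lebesgue integral is
     innermost; along any other axis the fibre over a fixed [t] is, and the induction hypothesis
     applies there. *)
  case: (unliftP ord0 i) => [j|] Ei; subst i.
    rewrite -(integral12_prod_meas1 intf).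
    transitivity (\int[leb]_x (cst 0%E x))%E; last by rewrite integral0.
    apply: eq_integral => t _.
    apply: (Hline j (fun y => f (row_cons t y)) B M) => //.
    + exact: (measurableT_comp mf (measurable_pair1 _)).
    + move=> x Hx; apply: f0 => h; apply: Hx => k.
      by have := h (lift ord0 k); rewrite row_consS.
    + move=> y; under eq_integral do rewrite row_cons_lineS; exact: H.
  rewrite -(integral21_prod_meas1 intf).
  transitivity (\int[mu]_x (cst 0%E x))%E; last by rewrite integral0.
  apply: eq_integral => y _; rewrite /fubini_G /= /iso' /=.
  under eq_integral do rewrite row_cons_line0; exact: H.
Qed.

End IteratedIntegral.

(** * Borel measurability from the coordinate functions *)

Section BorelMeasurability.
Context {R : realType} {n : nat} d (T : measurableType d) (iso : T -> 'rV[R]_n).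
Hypothesis miso : forall i, measurable_fun setT (fun t => iso t 0 i).

(** Measurability is known for coordinates only, so [O] is exhausted by the countably many open
    cubes with rational centre and half-side 1/(m+1) that it contains. *)
Lemma open_measurable_preimage (O : set 'rV[R]_n) :
  open O -> measurable (iso @^-1` O).
Proof.
move=> oO.
pose B (p : 'rV[rat]_n * nat) : set 'rV[R]_n :=
  [set x | forall i, x 0 i \in `]ratr (p.1 0 i) - p.2.+1%:R^-1,
                                 ratr (p.1 0 i) + p.2.+1%:R^-1[].
have mB p : measurable (iso @^-1` B p).
  rewrite (_ : _ @^-1` _ = \bigcap_(i in [set: 'I_n])
    ((fun t => iso t 0 i) @^-1` `]ratr (p.1 0 i) - p.2.+1%:R^-1,
                                 ratr (p.1 0 i) + p.2.+1%:R^-1[)); last first.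
    by apply/seteqP; split=> [x /= H i _|x /= H i]; have:= H i => // h; exact: h.
  apply: fin_bigcap_measurable => // i _.
  by rewrite -[X in measurable X]setTI; apply: miso.
rewrite (_ : O = \bigcup_p (if `[< B p `<=` O >] then B p else set0)); last first.
  apply/seteqP; split=> [x Ox|x [p _]]; last by case: asboolP => // h /h.
  have /nbhs_ballP[e /= e0 eO] : nbhs x O by apply: open_nbhs_nbhs.
  (* Two points of one cube differ by less than twice its half-side in each coordinate, hence the
     bound e / 2. *)
  have [m me] : exists m : nat, m.+1%:R^-1 < e / 2.
    have e20 : 0 < e / 2 by rewrite divr_gt0.
    exists (Num.truncn (e / 2)^-1).
    by rewrite invf_plt ?posrE // truncnS_gt.
  have /choice[q qP] : forall i : 'I_n, exists q : rat,
      ratr q \in `]x 0 i - m.+1%:R^-1, x 0 i + m.+1%:R^-1[.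
    move=> i; apply: rat_in_itvoo.
    by rewrite ltrD2l; apply: lt_trans (_ : _ < 0) _; rewrite ?oppr_lt0 invr_gt0.
  pose c : R := m.+1%:R^-1; rewrite -/c in me qP.
  exists (\row_i q i, m) => //; case: asboolP => [_ i|] /=.
    have := qP i; rewrite mxE !in_itv /= -/c => /andP[? ?].
    by clearbody c; apply/andP; split; lra.
  case=> y /= By; apply: eO; split => // i j.
  have := By j; have := qP j; rewrite (ord1 i) mxE !in_itv /= -/c => /andP[? ?] /andP[? ?].
  clearbody c; rewrite /ball /= ltr_norml; apply/andP; split; lra.
rewrite preimage_bigcup; apply: countable_bigcupT_measurable => // p.
by case: asboolP => _; [exact: mB|rewrite preimage_set0].
Qed.

Lemma continuous_measurable_comp (f : 'rV[R]_n -> R) :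
  continuous f -> measurable_fun setT (f \o iso).
Proof.
move=> cf mD; apply: (measurability _ (RGenOInfty.measurableE R)) => //.
move=> _ [_ [a ->] <-]; rewrite setTI comp_preimage.
apply: open_measurable_preimage; exact: open_comp.
Qed.

Lemma indic_measurable_comp (O : set 'rV[R]_n) :
  open O -> measurable_fun setT (\1_O \o iso : T -> R).
Proof.
move=> oO; rewrite (_ : _ \o _ = \1_(iso @^-1` O)); last first.
  by apply/funext => t /=; rewrite !indicE; congr (_%:R); congr nat_of_bool;
     apply/idP/idP; rewrite !inE.
by apply: measurable_indic; exact: open_measurable_preimage.
Qed.

End BorelMeasurability.

(** * Integration by parts *)

Lemma bounded_open_intervalE {R : realType} (I : set R) (M : R) :
  open I -> is_interval I -> I !=set0 -> I `<=` `[- M, M] ->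
  I = `]inf I, sup I[%classic.
Proof.
move=> oI iI I0 IM.
have lI : has_inf I.
  by split=> //; exists (- M) => x /IM /=; rewrite in_itv /= => /andP[].
have uI : has_sup I.
  by split=> //; exists M => x /IM /=; rewrite in_itv /= => /andP[].
apply/seteqP; split=> [x Ix|x /=]; rewrite /= in_itv /=; last first.
  move=> /andP[ax xb].
  have [y Iy yx] := inf_lt I0 ax; have [z Iz xz] := sup_gt I0 xb.
  by apply: (iI y z) => //; rewrite !ltW.
have /nbhs_ballP[e /= e0 eI] : nbhs x I by apply: open_nbhs_nbhs.
apply/andP; split.
  apply: (@le_lt_trans _ _ (x - e / 2)); last by lra.
  apply: inf_lbound; first by case: lI.
  by apply: eI; rewrite /ball /= opprB addrC subrK gtr0_norm; lra.
apply: (@lt_le_trans _ _ (x + e / 2)); first by lra.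
apply: sup_ubound; first by case: uI.
by apply: eI; rewrite /ball /= opprD addrA subrr add0r normrN gtr0_norm; lra.
Qed.

(** On each component of [U] the fundamental theorem of calculus gives a difference of two values of
    [g] at endpoints, both zero. *)
Lemma integral_derive_open {R : realType} (g dg : R -> R) (U : set R) (M : R) :
  (forall t : R, is_derive t 1 g (dg t)) -> continuous dg ->
  open U -> U `<=` `[- M, M] ->
  (forall t, closure U t -> ~ U t -> g t = 0) ->
  (\int[@lebesgue_measure R]_t (\1_U t * dg t)%:E = 0)%E.
Proof.
move=> gdg cdg oU UM g0.
pose mu := @lebesgue_measure R.
have mU : measurable U by exact: open_measurable.
transitivity (\int[mu]_(t in U) (dg t)%:E)%E.
  rewrite [RHS]integral_mkcond; apply: eq_integral => t _.
  by rewrite patchE indicE; case: ifP; rewrite ?mul1r ?mul0r.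
have intU : mu.-integrable U (EFin \o dg).
  apply: (@integrableS _ _ _ mu `[- M, M]) => //.
  apply: continuous_compact_integrable; first exact: segment_compact.
  exact: continuous_subspaceT.
rewrite (open_disjoint_itv_bigcup oU) integral_bigcup //; first last.
- by rewrite -(open_disjoint_itv_bigcup oU).
- by move=> k; apply: open_measurable; exact: open_disjoint_itv_open.
- exact: open_disjoint_itv_trivIset.
apply: eseries0 => k _ _.
set J := open_disjoint_itv oU k.
have JU : J `<=` U.
  by rewrite [X in _ `<=` X](open_disjoint_itv_bigcup oU) => x Ix; exists k.
have [->|/set0P J0] := eqVneq J set0; first by rewrite integral_set0.
have JE : J = `]inf J, sup J[%classic.
  apply: (@bounded_open_intervalE _ _ M) => //.
  - exact: open_disjoint_itv_open.
  - exact: open_disjoint_itv_is_interval.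
  - exact: subset_trans UM.
have ab : inf J < sup J.
  by case: J0 => x; rewrite {1}JE /= in_itv /= => /andP[h1 h2]; exact: (lt_trans h1 h2).
(* An endpoint of [J] outside [J] is outside all of [U]: another component containing it would be an
   open neighbourhood of it, hence meet [J], against disjointness. *)
have gend c : closure J c -> ~ J c -> g c = 0.
  move=> cI nI; apply: g0; first exact: (closure_subset JU).
  rewrite (open_disjoint_itv_bigcup oU) => -[j _ Ijc].
  have [y [Iy Ijy]] : J `&` open_disjoint_itv oU j !=set0.
    by apply: cI; apply: open_nbhs_nbhs; split => //; exact: open_disjoint_itv_open.
  have /trivIsetP tI := @open_disjoint_itv_trivIset _ _ oU.
  have [kj|kj] := eqVneq k j; first by apply: nI; rewrite /J kj.
  by have := tI k j Logic.I Logic.I kj; rewrite -/J => /seteqP[/(_ y) H _]; apply: H.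
have gb : g (sup J) = 0.
  apply: gend; last by rewrite {1}JE /= in_itv /= ltxx andbF.
  apply: closure_sup => //.
  by exists M => x /JU/UM /=; rewrite in_itv /= => /andP[].
have ga : g (inf J) = 0.
  apply: gend; last by rewrite {1}JE /= in_itv /= ltxx.
  move=> B /nbhs_ballP[e /= e0 eB].
  have [|y Jy ye] := @inf_lt _ _ (inf J + e) J0; first by rewrite ltrDl.
  exists y; split => //; apply: eB; rewrite /ball /= distrC gtr0_norm.
    by rewrite ltrBlDl.
  by move: Jy; rewrite {1}JE /= in_itv /= subr_gt0 => /andP[].
have mdg (A : set R) : measurable_fun A (EFin \o dg).
  by apply: measurable_funS (measurableT) _ _ => //;
    apply/measurable_EFinP; exact: continuous_measurable_fun.
have cg : continuous g.
  move=> x; apply: differentiable_continuous; apply/derivable1_diffP.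
  by have := gdg x => -[].
rewrite {1}JE -(@integral_itv_bndoo _ _ _ _ true false (mdg _)).
have := @continuous_FTC2 _ dg g (inf J) (sup J) ab.
rewrite ga gb subee // => -> //.
- exact: continuous_subspaceT.
- split.
  + by move=> x _; have := gdg x => -[].
  + apply: cvg_at_right_filter; exact: cg.
  + apply: cvg_at_left_filter; exact: cg.
- by move=> x _; rewrite derive1E; have := gdg x => -[].
Qed.

Section DivergenceOnDomain.
Context {R : realType} {n : nat}.
Implicit Types (f F : 'rV[R]_n -> R) (Omega : set 'rV[R]_n).

Lemma compact_boxed (M : R) : compact (boxed M : set 'rV[R]_n).
Proof.
rewrite (_ : boxed M = [set v : 'rV[R]_n | forall i, v ord0 i \in `[- M, M]]).
  apply: (@rV_compact _ _ (fun=> `[- M, M]%classic)) => _.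
  exact: segment_compact.
by apply/seteqP; split=> x /= H i; have := H i; rewrite in_itv /= ler_norml.
Qed.

Lemma continuous_bounded_boxed f (M : R) : continuous f ->
  exists B, 0 <= B /\ forall x, boxed M x -> `|f x| <= B.
Proof.
move=> cf.
have : bounded_set (f @` boxed M).
  apply: compact_bounded; apply: continuous_compact (@compact_boxed M).
  exact: continuous_subspaceT.
case=> B [_ /(_ (Num.max 0 B + 1))] H; exists (Num.max 0 B + 1); split.
  by rewrite addr_ge0 // le_max lexx.
move=> x bx; apply: H; last by exists x.
by rewrite (le_lt_trans (_ : _ <= Num.max 0 B)) ?ltrDl // le_max lexx orbT.
Qed.

Lemma is_derive_line F (i : 'I_n) (x : 'rV[R]_n) (t : R) :
  differentiable F (x + t *: delta_mx 0 i) ->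
  is_derive t 1 (fun s : R => F (x + s *: delta_mx 0 i))
    (partial i F (x + t *: delta_mx 0 i)).
Proof.
move=> dF; set y := x + _.
have E : (fun h : R => h^-1 *: (((fun s : R => F (x + s *: delta_mx 0 i)) \o shift t)
     (h *: (1 : R)) - F (x + t *: delta_mx 0 i))) =
  (fun h : R => h^-1 *: ((F \o shift y) (h *: delta_mx 0 i) - F y)).
  apply/funext => h; rewrite /= -/y; do 3 f_equal.
  by rewrite /y [h *: 1]mulr1 scalerDl addrCA.
apply: DeriveDef.
  by rewrite /derivable E; apply: diff_derivable.
by rewrite /derive E.
Qed.

Context d (T : measurableType d) (mu : {sigma_finite_measure set T -> \bar R})
  (iso : T -> 'rV[R]_n).
Hypothesis chart : lebesgue_chart mu iso.

Lemma indic_integrable Omega f (M : R) : open Omega -> Omega `<=` boxed M ->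
  continuous f -> mu.-integrable setT (fun t => (\1_Omega (iso t) * f (iso t))%:E).
Proof.
move=> oO OM cf; case: chart => miso _ Hbox _.
have [B [B0 fB]] := continuous_bounded_boxed M cf.
apply: (@bounded_integrable _ _ _ _ mu iso (fun x => \1_Omega x * f x) B M) => //.
- exact: Hbox.
- exact: (measurable_funM (indic_measurable_comp miso oO)
    (continuous_measurable_comp miso cf)).
- move=> x; rewrite indicE; case: (boolP (x \in Omega)); rewrite ?inE => Ox.
    by rewrite mul1r; apply: fB; apply: OM.
  by rewrite mul0r normr0.
- by move=> x nx; rewrite indicE memNset ?mul0r // => /OM.
Qed.

(* No regularity of the boundary is needed: every line meets [Omega] in a disjoint
   union of open intervals whose endpoints are boundary points. *)
Lemma integral_partial_domain Omega F (i : 'I_n) (M : R) :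
  open Omega -> Omega `<=` boxed M ->
  (forall x, differentiable F x) -> continuous (partial i F) ->
  (forall x, boundary Omega x -> F x = 0) ->
  (\int[mu]_t (\1_Omega (iso t) * partial i F (iso t))%:E = 0)%E.
Proof.
move=> oO OM dF cF F0; case: chart => miso _ _ Hline.
have [B [B0 fB]] := continuous_bounded_boxed M cF.
apply: (Hline i (fun x => \1_Omega x * partial i F x) B M).
- exact: (measurable_funM (indic_measurable_comp miso oO)
    (continuous_measurable_comp miso cF)).
- move=> x; rewrite indicE; case: (boolP (x \in Omega)); rewrite ?inE => Ox.
    by rewrite mul1r; apply: fB; apply: OM.
  by rewrite mul0r normr0.
- by move=> x nx; rewrite indicE memNset ?mul0r // => /OM.
move=> x.
pose l (t : R) : 'rV[R]_n := x + t *: delta_mx 0 i.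
have cl : continuous l.
  by move=> t; apply: cvgD; [exact: cvg_cst|apply: cvgZl; exact: cvg_id].
have -> : (fun t : R => (\1_Omega (l t) * partial i F (l t))%:E) =
  (fun t : R => (\1_(l @^-1` Omega) t * partial i F (l t))%:E).
  by apply/funext => t; rewrite !indicE.
(* If the point of parameter [t] lies in Omega, its i-th coordinate [x 0 i + t] is at most [M] in
   absolute value, which bounds [t]. *)
apply: (@integral_derive_open _ (F \o l) _ _ (M + `|x 0 i|)).
- by move=> t; apply: is_derive_line.
- by move=> t; apply: continuous_comp; [exact: cl|exact: cF].
- by apply: open_comp => // t _; exact: cl.
- move=> t /= /OM /(_ i); rewrite line_coord eqxx mulr1 in_itv /= -ler_norml => h.
  rewrite -[t](addKr (x 0 i)) addrC.
  by rewrite (le_trans (ler_normB _ _)) // lerD2r.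
- move=> t clt nt; apply: F0; split => // A /cl lA.
  by have [s [sU sA]] := clt _ lA; exists (l s).
Qed.

End DivergenceOnDomain.

(** * Smooth functions *)

Section SmoothFunctions.
Context {R : realType} {n : nat}.
Local Notation V := 'rV[R]_n.
Implicit Types (f g : V -> R) (i : 'I_n).

Lemma partialD i f g x : differentiable f x -> differentiable g x ->
  partial i (fun y => f y + g y) x = partial i f x + partial i g x.
Proof. by move=> df dg; apply: deriveD; apply: diff_derivable. Qed.

Lemma partialM i f g x : differentiable f x -> differentiable g x ->
  partial i (fun y => f y * g y) x = f x * partial i g x + g x * partial i f x.
Proof. by move=> df dg; apply: deriveM; apply: diff_derivable. Qed.

Lemma partial_cst i (c : R) x : partial i (fun=> c) x = 0.
Proof. exact: derive_cst. Qed.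

Lemma differentiable_expR f x : differentiable f x ->
  differentiable (fun y => expR (f y)) x.
Proof.
move=> df; apply: (@differentiable_comp _ _ _ _ f expR) => //.
by apply/derivable1_diffP.
Qed.

Lemma partial_expR i f x : differentiable f x ->
  partial i (fun y => expR (f y)) x = expR (f x) * partial i f x.
Proof.
move=> df; rewrite /partial deriveE; last exact: differentiable_expR.
have de : differentiable (expR : R -> R) (f x) by apply/derivable1_diffP.
rewrite (_ : (fun y => expR (f y)) = expR \o f) // diff_comp //=.
rewrite (diff1E de) [in RHS]deriveE //.
by rewrite derive1E derive_val /GRing.scale /= mulrC.
Qed.

(* This class is stable under partial derivatives, so smoothness of its members
   follows by induction on the number of derivatives. *)
Inductive smooth_closure : (V -> R) -> Prop :=
| smooth_closure_smooth f : smooth f -> smooth_closure f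
| smooth_closure_cst (c : R) : smooth_closure (fun=> c)
| smooth_closureD f g : smooth_closure f -> smooth_closure g ->
    smooth_closure (fun x => f x + g x)
| smooth_closureM f g : smooth_closure f -> smooth_closure g ->
    smooth_closure (fun x => f x * g x)
| smooth_closure_expR f : smooth_closure f -> smooth_closure (fun x => expR (f x)).

Lemma smooth_differentiable f : smooth f -> forall x, differentiable f x.
Proof. by move=> /(_ [::]). Qed.

Lemma smooth_partial i f : smooth f -> smooth (partial i f).
Proof.
move=> sf s x; have := sf (rcons s i) x.
by rewrite /iter_partial -cats1 foldr_cat.
Qed.

Lemma smooth_continuous f : smooth f -> continuous f.
Proof.
move=> sf x; apply: differentiable_continuous; exact: smooth_differentiable.
Qed.

Lemma smooth_closure_partial f : smooth_closure f ->
  (forall x, differentiable f x) /\ forall i, smooth_closure (partial i f).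
Proof.
elim=> {f} [f sf|c|f g sf [df pf] sg [dg pg]|f g sf [df pf] sg [dg pg]|f sf [df pf]].
- split; first exact: smooth_differentiable.
  by move=> i; constructor; exact: smooth_partial.
- split=> [x|i]; first exact: differentiable_cst.
  rewrite (_ : partial i _ = fun=> 0); first exact: smooth_closure_cst.
  by apply/funext => x; rewrite partial_cst.
- split=> [x|i]; first exact: differentiableD.
  rewrite (_ : partial i _ = fun x => partial i f x + partial i g x).
    exact: smooth_closureD.
  by apply/funext => x; rewrite partialD.
- split=> [x|i]; first exact: differentiableM.
  rewrite (_ : partial i _ =
      fun x => f x * partial i g x + g x * partial i f x).
    by apply: smooth_closureD; exact: smooth_closureM.
  by apply/funext => x; rewrite partialM.
- split=> [x|i]; first exact: differentiable_expR.
  rewrite (_ : partial i _ = fun x => expR (f x) * partial i f x).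
    by apply: smooth_closureM => //; exact: smooth_closure_expR.
  by apply/funext => x; rewrite partial_expR.
Qed.

Lemma smooth_closureP f : smooth_closure f -> smooth f.
Proof.
move=> sf s; elim/last_ind: s f sf => [|s i IH] f sf x.
  by have [] := smooth_closure_partial sf.
(* [rcons s i] makes [partial i] the innermost derivative, so the induction hypothesis is used for
   [partial i f], still in the class. *)
rewrite /iter_partial -cats1 foldr_cat /=; apply: IH.
by have [] := smooth_closure_partial sf.
Qed.

Lemma smooth_cst (c : R) : smooth (fun _ : V => c).
Proof. exact/smooth_closureP/smooth_closure_cst. Qed.

Lemma smoothD f g : smooth f -> smooth g -> smooth (fun x => f x + g x).
Proof.
by move=> sf sg; apply: smooth_closureP; apply: smooth_closureD; constructor.
Qed.

Lemma smoothM f g : smooth f -> smooth g -> smooth (fun x => f x * g x).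
Proof.
by move=> sf sg; apply: smooth_closureP; apply: smooth_closureM; constructor.
Qed.

Lemma smooth_sqr f : smooth f -> smooth (fun x => f x ^+ 2).
Proof. by move=> sf; exact: (smoothM sf sf). Qed.

Lemma smooth_expR f : smooth f -> smooth (fun x => expR (f x)).
Proof.
by move=> sf; apply: smooth_closureP; apply: smooth_closure_expR; constructor.
Qed.

Lemma smooth_sum (I : Type) (r : seq I) (P : pred I) (F : I -> V -> R) :
  (forall j, P j -> smooth (F j)) -> smooth (fun x => \sum_(j <- r | P j) F j x).
Proof.
move=> sF; elim: r => [|j r IH].
  rewrite (_ : (fun x => _) = fun=> 0); first exact: smooth_cst.
  by apply/funext => x; rewrite big_nil.
rewrite (_ : (fun x => _) = fun x => (if P j then F j x else 0) +
    \sum_(k <- r | P k) F k x); last first.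
  by apply/funext => x; rewrite big_cons; case: ifP; rewrite ?add0r.
apply: smoothD IH; case: (boolP (P j)) => Pj; [exact: sF|exact: smooth_cst].
Qed.

Lemma partialZ i (c : R) f x : smooth f ->
  partial i (fun y => c * f y) x = c * partial i f x.
Proof.
move=> sf; rewrite partialM; [|exact: differentiable_cst|exact: smooth_differentiable].
by rewrite partial_cst mulr0 addr0.
Qed.

Lemma partial_coord i j x : partial i (fun y : V => y 0 j) x = (j == i)%:R.
Proof.
have := @is_derive_line _ _ (fun y : V => y 0 j) i x 0
  (differentiable_coord _ _ _).
rewrite scale0r addr0 => -[_ <-].
rewrite (_ : (fun s : R => _) = (fun s : R => x 0 j + s * (j == i)%:R)); last first.
  by apply/funext => s; rewrite line_coord.
have : is_derive (0 : R) 1 (fun s : R => x 0 j + s * (j == i)%:R) (j == i)%:R.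
  by apply: is_derive_eq; rewrite add0r mul1r scale0r add0r [LHS]mulr1.
by case.
Qed.

Lemma smooth_coord j : smooth (fun x : V => x 0 j).
Proof.
move=> s; elim/last_ind: s => [|s i _] x; first exact: differentiable_coord.
rewrite /iter_partial -cats1 foldr_cat /=.
rewrite (_ : partial i _ = fun=> (j == i)%:R); first exact: smooth_cst.
by apply/funext => y; rewrite partial_coord.
Qed.

End SmoothFunctions.

(** * The transport operator and the energy identity *)

Section DomainIntegral.
Context {R : realType} {n : nat} d (T : measurableType d)
  (mu : {sigma_finite_measure set T -> \bar R}) (iso : T -> 'rV[R]_n).
Hypothesis chart : lebesgue_chart mu iso.
Variables (Omega : set 'rV[R]_n) (M : R).
Hypotheses (oO : open Omega) (OM : Omega `<=` boxed M).
Implicit Types f g : 'rV[R]_n -> R.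

(** The indicator stays in the integrand, as in [H1_norm_sq]. Integrands have both signs, so the
    rules below obtain integrability from continuity on a bounded set. *)
Definition domain_integral f : \bar R :=
  (\int[mu]_t (\1_Omega (iso t) * f (iso t))%:E)%E.

Lemma domain_integralD f g : continuous f -> continuous g ->
  domain_integral (fun x => f x + g x) = (domain_integral f + domain_integral g)%E.
Proof.
move=> cf cg; rewrite /domain_integral -integralD //.
- by apply: eq_integral => t _; rewrite mulrDr EFinD.
- exact: (indic_integrable chart oO OM cf).
- exact: (indic_integrable chart oO OM cg).
Qed.

Lemma domain_integralZ c f : continuous f ->
  domain_integral (fun x => c * f x) = (c%:E * domain_integral f)%E.
Proof.
move=> cf; rewrite /domain_integral -integralZl //.
  by apply: eq_integral => t _; rewrite mulrCA EFinM.
exact: (indic_integrable chart oO OM cf).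
Qed.

Lemma domain_integral_sum (I : Type) (r : seq I) (F : I -> 'rV[R]_n -> R) :
  (forall i, continuous (F i)) ->
  domain_integral (fun x => \sum_(i <- r) F i x) =
  (\sum_(i <- r) domain_integral (F i))%E.
Proof.
move=> cF; rewrite /domain_integral -(integral_sum measurableT); last first.
  by move=> i; exact: (indic_integrable chart oO OM (cF i)).
by apply: eq_integral => t _; rewrite mulr_sumr sumEFin.
Qed.

Lemma le_domain_integral f g : continuous f -> continuous g ->
  (forall x, Omega x -> f x <= g x) ->
  (domain_integral f <= domain_integral g)%E.
Proof.
move=> cf cg fg; apply: le_integral => //.
- exact: (indic_integrable chart oO OM cf).
- exact: (indic_integrable chart oO OM cg).
- move=> t _; rewrite lee_fin indicE; case: (boolP (_ \in _)); rewrite ?inE => Ot.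
    by rewrite !mul1r; exact: fg.
  by rewrite !mul0r.
Qed.

Lemma domain_integral_cst c :
  domain_integral (fun=> c) = (c * fine (mu (iso @^-1` Omega)))%:E.
Proof.
have [miso _ Hbox _] := chart.
rewrite /domain_integral EFinM fineK; last first.
  rewrite ge0_fin_numE //; apply: le_lt_trans (Hbox M).
  by apply: le_measure; rewrite ?inE;
    [exact: open_measurable_preimage|exact: measurable_boxed|move=> t; exact: OM].
under eq_integral => t _ do rewrite mulrC EFinM.
rewrite integralZl //.
  congr (_ * _)%E; rewrite -[iso @^-1` Omega]setIT -integral_indic //.
  exact: open_measurable_preimage.
have c1 : continuous (fun _ : 'rV[R]_n => 1 : R) by exact: cst_continuous.
have := indic_integrable chart oO OM c1.
by under [X in _.-integrable _ X]funext do rewrite mulr1.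
Qed.

Lemma integral_Rn_domain f : continuous f -> (forall x, 0 <= f x) ->
  integral_Rn (fun x => (\1_Omega x * f x)%:E) = domain_integral f.
Proof.
move=> cf f0; have [miso Hint _ _] := chart; rewrite Hint //.
  by move=> x; rewrite lee_fin mulr_ge0 // indicE ler0n.
exact: measurable_int (indic_integrable chart oO OM cf).
Qed.

End DomainIntegral.

Section Conormal.
Context {R : realType} {n : nat} (gamma : 'rV[R]_n -> 'M[R]_n).
Hypothesis sgamma : smooth_mx gamma.
Implicit Types (u v phi : 'rV[R]_n -> R) (s c : R).

(** The i-th component of the conormal field gamma grad u, whose divergence is [div_gamma_grad] by
    conversion. *)
Definition flux u (i : 'I_n) : 'rV[R]_n -> R :=
  fun y => \sum_(j < n) gamma y i j * partial j u y.

Lemma smooth_flux u i : smooth u -> smooth (flux u i).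
Proof.
move=> su; apply: (@smooth_sum _ _ _ _ _ (fun j y => gamma y i j * partial j u y)).
by move=> j _; apply: smoothM; [exact: sgamma|exact: smooth_partial].
Qed.

Lemma div_gamma_gradE u x : div_gamma_grad gamma u x = \sum_i partial i (flux u i) x.
Proof. by []. Qed.

Lemma gamma_dotE u v x : gamma_dot gamma u v x = \sum_i flux u i x * partial i v x.
Proof. by apply: eq_bigr => i _; rewrite mulr_suml. Qed.

Lemma gamma_dotC u v x : (gamma x)^T = gamma x ->
  gamma_dot gamma u v x = gamma_dot gamma v u x.
Proof.
move=> sym; rewrite /gamma_dot exchange_big; apply: eq_bigr => i _.
apply: eq_bigr => j _; rewrite mulrAC; congr (_ * _ * _).
by rewrite -{1}sym mxE.
Qed.

(** The shape [u + c * v] serves several ends: a new term of the expansion, subtraction with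
    [c = -1], and the field gamma grad u + s u gamma grad phi. *)
Lemma partial_lin i c u v x : smooth u -> smooth v ->
  partial i (fun y => u y + c * v y) x = partial i u x + c * partial i v x.
Proof.
move=> su sv; rewrite partialD ?partialZ //; apply: smooth_differentiable => //.
by apply: smoothM => //; exact: smooth_cst.
Qed.

Lemma flux_lin i c u v : smooth u -> smooth v ->
  flux (fun y => u y + c * v y) i = (fun y => flux u i y + c * flux v i y).
Proof.
move=> su sv; apply/funext => y; rewrite /flux mulr_sumr -big_split.
by apply: eq_bigr => j _; rewrite partial_lin // mulrDr mulrCA.
Qed.

(** The operator div gamma grad - tau a conjugated by e^(s phi), with s^2 = tau, once the eikonal
    equation has removed the terms in s^2. *)
Definition transport s phi u x :=
  div_gamma_grad gamma u x + 2 * s * gamma_dot gamma phi u x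
  + s * div_gamma_grad gamma phi x * u x.

Lemma transport_lin s phi c u v x : smooth u -> smooth v ->
  transport s phi (fun y => u y + c * v y) x =
  transport s phi u x + c * transport s phi v x.
Proof.
move=> su sv; rewrite /transport.
have -> : div_gamma_grad gamma (fun y => u y + c * v y) x =
    div_gamma_grad gamma u x + c * div_gamma_grad gamma v x.
  rewrite !div_gamma_gradE mulr_sumr -big_split; apply: eq_bigr => i _.
  by rewrite flux_lin // partial_lin //; exact: smooth_flux.
have -> : gamma_dot gamma phi (fun y => u y + c * v y) x =
    gamma_dot gamma phi u x + c * gamma_dot gamma phi v x.
  rewrite !gamma_dotE mulr_sumr -big_split; apply: eq_bigr => i _.
  by rewrite partial_lin // mulrDr mulrCA.
move: (div_gamma_grad _ u x) (div_gamma_grad _ v x) (div_gamma_grad _ phi x)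
  (gamma_dot _ phi u x) (gamma_dot _ phi v x) (u x) (v x) => *.
ring.
Qed.

(** The two cross terms stay separate: symmetry of gamma is given on the closure of Omega only, and
    they are merged later at a fixed point. *)
Lemma div_gamma_grad_conj s phi u x : smooth phi -> smooth u ->
  div_gamma_grad gamma (fun y => expR (s * phi y) * u y) x =
  expR (s * phi x) * (div_gamma_grad gamma u x
    + s * (gamma_dot gamma u phi x + gamma_dot gamma phi u x)
    + s * u x * div_gamma_grad gamma phi x
    + s ^+ 2 * u x * gamma_dot gamma phi phi x).
Proof.
move=> sphi su.
have ssphi : smooth (fun y => s * phi y) by apply: smoothM => //; exact: smooth_cst.
have se := smooth_expR ssphi.
have pe i y : partial i (fun z => expR (s * phi z)) y =
    expR (s * phi y) * (s * partial i phi y).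
  by rewrite partial_expR ?partialZ //; exact: smooth_differentiable.
have fE i : flux (fun y => expR (s * phi y) * u y) i =
    (fun y => expR (s * phi y) * (flux u i y + s * (u y * flux phi i y))).
  apply/funext => y; rewrite /flux !mulr_sumr -big_split mulr_sumr.
  apply: eq_bigr => j _; rewrite partialM; try exact: smooth_differentiable.
  rewrite pe /=; move: (partial j u y) (partial j phi y) (gamma y i j) (u y)
    (expR _) => *; ring.
rewrite div_gamma_gradE !gamma_dotE (div_gamma_gradE u) (div_gamma_gradE phi).
rewrite -big_split !mulr_sumr -!big_split mulr_sumr; apply: eq_bigr => i _ /=.
have sfu := smooth_flux i su; have sfp := smooth_flux i sphi.
have sup : smooth (fun y => u y * flux phi i y) by exact: smoothM.
rewrite fE partialM; first last.
- apply: smooth_differentiable; apply: smoothD => //.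
  by apply: smoothM => //; exact: smooth_cst.
- exact: smooth_differentiable.
rewrite pe partial_lin // partialM; try exact: smooth_differentiable.
move: (partial i (flux u i) x) (partial i (flux phi i) x) (partial i u x)
  (partial i phi x) (flux u i x) (flux phi i x) (u x) (expR _) => *.
ring.
Qed.

Definition energy_field s phi u i : 'rV[R]_n -> R :=
  fun x => u x * (flux u i x + s * (u x * flux phi i x)).

Lemma smooth_energy_field s phi u i : smooth phi -> smooth u ->
  smooth (energy_field s phi u i).
Proof.
move=> sphi su; apply: smoothM => //; apply: smoothD; first exact: smooth_flux.
apply: smoothM; first exact: smooth_cst.
by apply: smoothM => //; exact: smooth_flux.
Qed.

(* The first-order terms of the transport operator tested against [u] form an
   exact divergence, so the large parameter [s] drops out of the energy. *)
Lemma div_energy_field s phi u x : smooth phi -> smooth u ->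
  \sum_i partial i (energy_field s phi u i) x =
  gamma_dot gamma u u x + u x * transport s phi u x.
Proof.
move=> sphi su; rewrite /transport !gamma_dotE !div_gamma_gradE.
rewrite !(mulr_sumr, mulr_suml) -!big_split !(mulr_sumr, mulr_suml) -!big_split.
apply: eq_bigr => i _ /=.
have sfu := smooth_flux i su; have sfp := smooth_flux i sphi.
have sup : smooth (fun y => u y * flux phi i y) by exact: smoothM.
rewrite partialM; first last.
- apply: smooth_differentiable; apply: smoothD => //.
  by apply: smoothM => //; exact: smooth_cst.
- exact: smooth_differentiable.
rewrite partial_lin // partialM; try exact: smooth_differentiable.
move: (partial i (flux u i) x) (partial i (flux phi i) x) (partial i u x)
  (flux u i x) (flux phi i x) (u x) => *.
ring.
Qed.

End Conormal.

(** * Uniform ellipticity *)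

(** The quadratic form attains a positive minimum on the product of [K] and the unit sphere;
    homogeneity of degree 2 covers the other vectors. *)
Lemma uniform_ellipticity {R : realType} {n : nat} (K : set 'rV[R]_n)
    (gamma : 'rV[R]_n -> 'M[R]_n) :
  compact K -> (forall i j, continuous (fun x => gamma x i j)) ->
  (forall x, K x -> forall v : 'rV[R]_n, v != 0 ->
     0 < (v *m gamma x *m v^T) 0 0) ->
  exists2 c, 0 < c & forall x, K x -> forall v : 'rV[R]_n,
    c * (\sum_i v 0 i ^+ 2) <= \sum_i \sum_j gamma x i j * v 0 j * v 0 i.
Proof.
move=> cK cg pos.
pose Q (p : 'rV[R]_n * 'rV[R]_n) :=
  \sum_i \sum_j gamma p.1 i j * p.2 0 j * p.2 0 i.
have Qpos x v : K x -> v != 0 -> 0 < Q (x, v).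
  move=> Kx v0; have := pos x Kx v v0; congr (_ < _).
  rewrite mxE /Q /=.
  under eq_bigr do rewrite !mxE mulr_suml.
  rewrite exchange_big /=; apply: eq_bigr => i _; apply: eq_bigr => j _.
  by rewrite -mulrA mulrC.
have zero c x : c * (\sum_i (0 : 'rV[R]_n) 0 i ^+ 2) <=
    \sum_i \sum_j gamma x i j * (0 : 'rV[R]_n) 0 j * (0 : 'rV[R]_n) 0 i.
  rewrite [X in c * X]big1 => [|i _]; last by rewrite mxE expr0n.
  rewrite mulr0 sumr_ge0 // => i _; rewrite sumr_ge0 // => j _.
  by rewrite !mxE mulr0.
have cQ : continuous Q.
  have c2 i : continuous (fun p : 'rV[R]_n * 'rV[R]_n => p.2 0 i).
    move=> p; apply: (@continuous_comp _ _ _ snd (fun v : 'rV[R]_n => v 0 i)).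
      exact: cvg_snd.
    exact: coord_continuous.
  have c1 i j : continuous (fun p : 'rV[R]_n * 'rV[R]_n => gamma p.1 i j).
    move=> p; apply: (@continuous_comp _ _ _ fst (fun x => gamma x i j)).
      exact: cvg_fst.
    exact: cg.
  move=> p; apply: cvg_big => [|i _]; first exact: add_continuous.
  apply: cvg_big => [|j _]; first exact: add_continuous.
  by apply: cvgM; [apply: cvgM; [exact: c1|exact: c2]|exact: c2].
pose S : set 'rV[R]_n := [set v | `|v| = 1].
have cS : compact S.
  apply: bounded_closed_compact.
    by exists 1; split => // y y1 v /= ->; exact: ltW.
  apply: (@closed_comp _ _ (fun v : 'rV[R]_n => `|v|) [set 1 : R]).
    by move=> v _; exact: norm_continuous.
  exact: closed_eq.
(* The product is empty when [K] is empty or n = 0. Then any [v] over a point of [K] is zero, and c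
   = 1 will do. *)
have [KS|] := pselect ((K `*` S) !=set0); last first.
  move=> KS0; exists 1 => // x Kx v.
  have v0 : v = 0.
    apply/eqP; apply/negP => /negP v0; apply: KS0; exists (x, `|v|^-1 *: v).
    split => //=; rewrite /S /= normrZ normfV normr_id mulVf // normr_eq0 //.
  by rewrite v0; exact: zero.
have [[x0 v0]] := compact_EVT_min KS (compact_setX cK cS)
  (continuous_subspaceT cQ).
rewrite inE => -[/= Kx0 Sv0] Qmin.
have q0 : 0 < Q (x0, v0).
  by apply: Qpos => //; rewrite -normr_gt0 Sv0.
have n0 : (0 < n)%N.
  rewrite lt0n; apply/eqP => n0; have /eqP := oner_neq0 R; apply.
  rewrite -Sv0 (_ : v0 = 0) ?normr0 //; apply/rowP => -[m m_lt].
  by have := m_lt; rewrite [X in (_ < X)%N]n0.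
(* The norm is the maximum norm, so the sum of squares is at most n times its square. *)
exists (Q (x0, v0) / n%:R); first by rewrite divr_gt0 // ltr0n.
move=> x Kx v.
have [->|v0'] := eqVneq v 0; first exact: zero.
have nv : 0 < `|v| by rewrite normr_gt0.
have : Q (x0, v0) <= Q (x, `|v|^-1 *: v).
  apply: Qmin; rewrite inE; split => //=.
  by rewrite /S /= normrZ normfV normr_id mulVf // normr_eq0.
have -> : Q (x, `|v|^-1 *: v) = `|v| ^- 2 * Q (x, v).
  rewrite /Q /= mulr_sumr; apply: eq_bigr => i _; rewrite mulr_sumr.
  by apply: eq_bigr => j _; rewrite !mxE -exprVn; ring.
rewrite -[Q (x, v)]/(\sum_i \sum_j gamma x i j * v 0 j * v 0 i) mulrC => H.
rewrite -mulrA; apply: (@le_trans _ _ (Q (x0, v0) * `|v| ^+ 2)); last first.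
  by rewrite -ler_pdivlMr // exprn_gt0.
rewrite ler_pM2l // ler_pdivrMl ?ltr0n //.
rewrite -[n in n%:R]card_ord -sum1_card natr_sum mulr_suml.
apply: ler_sum => i _; rewrite mul1r -real_normK ?num_real //.
rewrite ler_sqr ?nnegrE //.
by rewrite [`|v|]mx_normrE; apply/bigmax_geP; right; exists (0, i).
Qed.

(** * The remainder of the expansion *)

Section BoundedSets.
Context {R : realType} {n : nat}.

Lemma norm_le_boxed (M : R) (x : 'rV[R]_n) : `|x| <= M -> boxed M x.
Proof.
move=> xM i; apply: le_trans xM.
by rewrite [`|x|]mx_normrE; apply/bigmax_geP; right; exists (0, i).
Qed.

Lemma closed_boxed (M : R) : closed (boxed M : set 'rV[R]_n).
Proof. by apply: compact_closed; [exact: norm_hausdorff|exact: compact_boxed]. Qed.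

Lemma closure_sub_boxed (Omega : set 'rV[R]_n) (M : R) :
  Omega `<=` boxed M -> closure Omega `<=` boxed M.
Proof. 
by move/closureS; rewrite -((closure_id (boxed M)).1 (@closed_boxed M)). Qed.

Lemma compact_closure_boxed (Omega : set 'rV[R]_n) (M : R) :
  Omega `<=` boxed M -> compact (closure Omega).
Proof.
move=> OM; apply: (subclosed_compact _ (@compact_boxed _ _ M)).
  exact: closed_closure.
exact: closure_sub_boxed.
Qed.

End BoundedSets.

Section WKBExpansion.
Context {R : realType} {n : nat} (gamma : 'rV[R]_n -> 'M[R]_n).
Hypothesis sgamma : smooth_mx gamma.
Variables (phi : 'rV[R]_n -> R) (aj : nat -> 'rV[R]_n -> R) (N : nat).
Hypothesis saj : forall j, (j <= N)%N -> smooth (aj j).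

(** [m] counts terms: the boundary data are [wkb_sum s N.+1], the expansion of the theorem is
    [wkb_sum s N]. *)
Definition wkb_sum (s : R) m x := \sum_(j < m) aj j x / s ^+ j.

Lemma wkb_sumS s m :
  wkb_sum s m.+1 = (fun x => wkb_sum s m x + s ^- m * aj m x).
Proof. by apply/funext => x; rewrite /wkb_sum big_ord_recr /= [_ / _]mulrC. Qed.

Lemma smooth_wkb_sum s m : (m <= N.+1)%N -> smooth (wkb_sum s m).
Proof.
move=> mN; apply: (@smooth_sum _ _ _ _ _ (fun (j : 'I_m) x => aj j x / s ^+ j)).
move=> j _; apply: smoothM; last exact: smooth_cst.
by apply: saj; rewrite -ltnS (leq_trans (ltn_ord j)).
Qed.

(** The sum telescopes: the first-order part of [transport] on a_(m+1) / s^(m+1) equals - s^(-m)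
    div(gamma grad a_m), which cancels the residue of the previous terms. *)
Lemma transport_wkb_sum s x m : s != 0 -> (m <= N)%N ->
  2 * gamma_dot gamma phi (aj 0%N) x
    + div_gamma_grad gamma phi x * aj 0%N x = 0 ->
  (forall j, (j < N)%N -> 2 * gamma_dot gamma phi (aj j.+1) x
     + div_gamma_grad gamma phi x * aj j.+1 x = - div_gamma_grad gamma (aj j) x) ->
  transport gamma s phi (wkb_sum s m.+1) x = s ^- m * div_gamma_grad gamma (aj m) x.
Proof.
move=> s0 mN eq0 eqS.
have tr j : transport gamma s phi (aj j) x = div_gamma_grad gamma (aj j) x +
    s * (2 * gamma_dot gamma phi (aj j) x + div_gamma_grad gamma phi x * aj j x).
  by rewrite /transport mulrDr addrA !mulrA [s * 2]mulrC.
elim: m mN => [_|m IH mN].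
  rewrite (_ : wkb_sum s 1 = aj 0%N).
    by rewrite tr eq0 mulr0 addr0 expr0 invr1 mul1r.
  by apply/funext => y; rewrite /wkb_sum big_ord1 expr0 divr1.
rewrite wkb_sumS transport_lin //; last 2 first.
- by apply: smooth_wkb_sum; exact: ltnW.
- exact: saj.
rewrite IH; last exact: ltnW.
rewrite tr eqS // mulrDr mulrA exprS invfM -mulrA mulrCA mulrA.
move: (div_gamma_grad _ _ _) (div_gamma_grad _ _ _) (s ^- m) => p q r.
by field.
Qed.

Variable tau : R.
Hypothesis tau0 : 0 < tau.
Local Notation s := (Num.sqrt tau).

Lemma transport_remainder a w x : smooth phi -> smooth w ->
  (gamma x)^T = gamma x -> gamma_dot gamma phi phi x = a x ->
  2 * gamma_dot gamma phi (aj 0%N) x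
    + div_gamma_grad gamma phi x * aj 0%N x = 0 ->
  (forall j, (j < N)%N -> 2 * gamma_dot gamma phi (aj j.+1) x
     + div_gamma_grad gamma phi x * aj j.+1 x = - div_gamma_grad gamma (aj j) x) ->
  div_gamma_grad gamma w x - tau * a x * w x = 0 ->
  transport gamma s phi
    (fun y => expR (- (s * phi y)) * w y - wkb_sum s N.+1 y) x =
  - (s ^- N * div_gamma_grad gamma (aj N) x).
Proof.
move=> sphi sw sym eik eq0 eqS eqw.
have s0 : s != 0 by rewrite gt_eqF // sqrtr_gt0.
pose U y := expR (- (s * phi y)) * w y.
have sU : smooth U.
  apply: smoothM => //; apply: smooth_expR.
  rewrite (_ : (fun x => _) = fun y => - s * phi y).
    by apply: smoothM => //; exact: smooth_cst.
  by apply/funext => y; rewrite mulNr.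
(* In this form [div_gamma_grad_conj] applies to the equation of [w]; cancelling the exponential
   shows that [transport] annihilates [U]. *)
have wE : w = fun y => expR (s * phi y) * U y.
  by apply/funext => y; rewrite /U mulrA -expRD subrr expR0 mul1r.
rewrite (_ : (fun y => _) = fun y => U y + -1 * wkb_sum s N.+1 y); last first.
  by apply/funext => y; rewrite mulN1r.
rewrite transport_lin //; last exact: smooth_wkb_sum.
rewrite transport_wkb_sum // mulN1r (_ : transport _ _ _ U x = 0) ?add0r //.
have e0 : expR (s * phi x) != 0 by rewrite gt_eqF ?expR_gt0.
have s2 : s ^+ 2 = tau by rewrite sqr_sqrtr // ltW.
move: eqw; rewrite wE div_gamma_grad_conj // eik (gamma_dotC U phi sym) s2.
rewrite /transport.
move: (div_gamma_grad _ U x) (div_gamma_grad _ phi x) (gamma_dot _ phi U x)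
  (U x) (a x) => D P G Ux ax.
move=> H; apply: (mulfI e0); rewrite mulr0 -[RHS]H; ring.
Qed.

End WKBExpansion.

(* Ellipticity, the Poincare inequality and Young's inequality, pointwise. *)
Lemma remainder_pointwise {R : realType} (c M G D u P p0 x0 h q E A : R) :
  0 < c -> `|x0| <= M -> p0 ^+ 2 <= P -> `|h| <= G -> c * P <= E ->
  A = (16 * M ^+ 2 + 2) / c ->
  2 * u ^+ 2 + 2 * P + 2 * q ^+ 2 * D <=
  A * (E + u * - (q * h)) + 8 * (u ^+ 2 + 2 * x0 * u * p0)
  + (2 * D + A ^+ 2 * G ^+ 2 / 8) * q ^+ 2.
Proof.
move=> c0 x0M p0P hG cE AE0.
have A0 : 0 <= A by rewrite AE0 divr_ge0 ?(ltW c0) // addr_ge0 // mulr_ge0 // sqr_ge0.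
have AE : (16 * M ^+ 2 + 2) * P <= A * E.
  apply: le_trans (ler_wpM2l A0 cE).
  by rewrite [A * _]mulrA AE0 divfK // gt_eqF.
have h2 : h ^+ 2 <= G ^+ 2.
  by rewrite -real_normK ?num_real // ler_sqr ?nnegrE // (le_trans _ hG).
have x2 : x0 ^+ 2 <= M ^+ 2.
  by rewrite -real_normK ?num_real // ler_sqr ?nnegrE // (le_trans _ x0M).
have xp : x0 ^+ 2 * p0 ^+ 2 <= M ^+ 2 * P by rewrite ler_pM // sqr_ge0.
(* The weights balance: of 8 u^2, this inequality takes 2, eight copies of [young2] take 4, and 2
   remain for the left side. Those copies also cost 16 M^2 P, the first part of [AE], whose other
   part supplies 2 P. *)
have young1 : A * (u * (q * h)) <= 2 * u ^+ 2 + A ^+ 2 * h ^+ 2 / 8 * q ^+ 2.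
  have := sqr_ge0 (4 * u - A * q * h); lra.
have young1' : A ^+ 2 * h ^+ 2 / 8 * q ^+ 2 <= A ^+ 2 * G ^+ 2 / 8 * q ^+ 2.
  by rewrite ler_wpM2r ?sqr_ge0 // ler_pM2r ?invr_gt0 // ler_wpM2l ?sqr_ge0.
have young2 : - (2 * x0 * u * p0) <= u ^+ 2 / 2 + 2 * (x0 ^+ 2 * p0 ^+ 2).
  have := sqr_ge0 (u + 2 * x0 * p0); lra.
lra.
Qed.

(** * The H^1 bound, uniform in the large parameter *)

Section RemainderEstimate.
Context {R : realType} {k : nat}.
Local Notation n := k.+1.
Context d (T : measurableType d)
  (mu : {sigma_finite_measure set T -> \bar R}) (iso : T -> 'rV[R]_n).
Hypothesis chart : lebesgue_chart mu iso.
Variables (Omega : set 'rV[R]_n) (M : R).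
Hypotheses (oO : open Omega) (OM : Omega `<=` boxed M).
Variable gamma : 'rV[R]_n -> 'M[R]_n.
Hypothesis sgamma : smooth_mx gamma.
Variables (c D G : R) (phi b h : 'rV[R]_n -> R).
Hypothesis c0 : 0 < c.
Hypothesis ellip : forall x, Omega x -> forall v : 'rV[R]_n,
  c * (\sum_i v 0 i ^+ 2) <= \sum_i \sum_j gamma x i j * v 0 j * v 0 i.
Hypotheses (sphi : smooth phi) (sb : smooth b).
Hypothesis bD : forall x, Omega x -> b x ^+ 2 + \sum_i partial i b x ^+ 2 <= D.
Hypothesis hG : forall x, Omega x -> `|h x| <= G.

Lemma H1_norm_sqE v : smooth v ->
  H1_norm_sq Omega v =
  domain_integral mu iso Omega (fun x => v x ^+ 2 + \sum_i partial i v x ^+ 2).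
Proof.
move=> sv; have sp i := smooth_sqr (smooth_partial i sv).
rewrite (domain_integralD chart oO OM); first last.
- by apply: smooth_continuous; apply: smooth_sum => i _; exact: sp.
- exact: smooth_continuous (smooth_sqr sv).
rewrite (domain_integral_sum chart oO OM); last first.
  by move=> i; exact: smooth_continuous (sp i).
rewrite /H1_norm_sq (integral_Rn_domain chart oO OM
  (smooth_continuous (smooth_sqr sv))); last by move=> x; exact: sqr_ge0.
congr (_ + _)%E; apply: eq_bigr => i _.
rewrite (integral_Rn_domain chart oO OM (smooth_continuous (sp i))) //.
by move=> x; exact: sqr_ge0.
Qed.

(** Used with q = s^(-N), b = a_N and h = div(gamma grad a_N). The bound depends on [s] only through
    [q], because the divergence carrying [s] has zero integral. *)
Lemma H1_remainder_le (s q : R) u : smooth u ->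
  (forall x, boundary Omega x -> u x = 0) ->
  (forall x, Omega x -> transport gamma s phi u x = - (q * h x)) ->
  (H1_norm_sq Omega (fun x => u x + q * b x)%R <=
   ((2 * D + ((16 * M ^+ 2 + 2) / c) ^+ 2 * G ^+ 2 / 8) * q ^+ 2 *
     fine (mu (iso @^-1` Omega)))%:E)%E.
Proof.
move=> su u0 equ; set A := (_ / c); set C1 := _ + _ / 8.
have sE i : smooth (energy_field gamma s phi u i) by exact: smooth_energy_field.
pose K (y : 'rV[R]_n) := y 0 ord0 * (u y * u y).
have sK : smooth K by apply: smoothM; [exact: smooth_coord|exact: smoothM].
have dK x : partial ord0 K x = u x ^+ 2 + 2 * x 0 ord0 * u x * partial ord0 u x.
  rewrite /K partialM; first last.
  - exact/smooth_differentiable/smoothM.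
  - exact/smooth_differentiable/smooth_coord.
  rewrite partialM; try exact: smooth_differentiable.
  rewrite partial_coord eqxx [X in _ + X]mulr1.
  move: (partial ord0 u x) (u x) (x 0 ord0) => *; ring.
have sqb : smooth (fun x => q * b x) by apply: smoothM => //; exact: smooth_cst.
have sv : smooth (fun x => u x + q * b x) by exact: smoothD.
have scE : smooth (fun x => A * \sum_i partial i (energy_field gamma s phi u i) x).
  apply: smoothM; first exact: smooth_cst.
  by apply: smooth_sum => i _; exact: smooth_partial.
have scK : smooth (fun x => 8 * partial ord0 K x).
  by apply: smoothM; [exact: smooth_cst|exact: smooth_partial].
have sC : smooth (fun _ : 'rV[R]_n => C1 * q ^+ 2) by exact: smooth_cst.
have cE : continuous (fun x => \sum_i partial i (energy_field gamma s phi u i) x).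
  by apply: smooth_continuous; apply: smooth_sum => i _; exact: smooth_partial.
have cK := smooth_continuous (smooth_partial ord0 sK).
rewrite H1_norm_sqE //.
apply: (@le_trans _ _ (domain_integral mu iso Omega (fun x =>
   A * (\sum_i partial i (energy_field gamma s phi u i) x) +
   8 * partial ord0 K x + C1 * q ^+ 2))); last first.
  rewrite !(domain_integralD chart oO OM) //;
    try (by apply: smooth_continuous => //; exact: smoothD).
  rewrite (domain_integralZ chart oO OM _ cE) (domain_integralZ chart oO OM _ cK).
  rewrite (domain_integral_sum chart oO OM); last first.
    by move=> i; apply: smooth_continuous; exact: smooth_partial.
  rewrite big1 => [|i _]; last first.
    apply: (integral_partial_domain chart oO OM).
    - exact: smooth_differentiable.
    - by apply: smooth_continuous; exact: smooth_partial.
    - by move=> x /u0 ux; rewrite /energy_field ux mul0r.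
  rewrite (_ : domain_integral _ _ _ (partial ord0 K) = 0%E); last first.
    apply: (integral_partial_domain chart oO OM).
    - exact: smooth_differentiable.
    - by apply: smooth_continuous; exact: smooth_partial.
    - by move=> x /u0 ux; rewrite /K ux mul0r mulr0.
  by rewrite !mule0 !add0e (domain_integral_cst chart oO OM).
apply: (le_domain_integral chart oO OM).
- apply: smooth_continuous; apply: smoothD; first exact: smooth_sqr.
  by apply: smooth_sum => i _; apply: smooth_sqr; exact: smooth_partial.
- by apply: smooth_continuous; apply: smoothD => //; exact: smoothD.
move=> x Ox; rewrite div_energy_field // equ // dK.
have el := ellip Ox (\row_i partial i u x).
pose P := \sum_i partial i u x ^+ 2.
apply: (@le_trans _ _ (2 * u x ^+ 2 + 2 * P + 2 * q ^+ 2 * D)); last first.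
  apply: (@remainder_pointwise _ c M) => //.
  - exact: OM.
  - by rewrite /P (bigD1 ord0) //= lerDl sumr_ge0 // => i _; exact: sqr_ge0.
  - exact: hG.
  - move: el; rewrite /P /gamma_dot; under eq_bigr do rewrite mxE.
    by move/le_trans; apply; rewrite le_eqVlt; apply/orP; left; apply/eqP;
       apply: eq_bigr => i _; apply: eq_bigr => j _; rewrite !mxE.
(* Separates [u] from [q * b] in the value and in each derivative; this is the origin of the factors
   2 on the left of [remainder_pointwise]. *)
have sq2 (y z : R) : (y + q * z) ^+ 2 <= 2 * y ^+ 2 + 2 * q ^+ 2 * z ^+ 2.
  have := sqr_ge0 (y - q * z); lra.
apply: (@le_trans _ _ (2 * u x ^+ 2 + 2 * P +
    2 * q ^+ 2 * (b x ^+ 2 + \sum_i partial i b x ^+ 2))); last first.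
  by rewrite lerD2l ler_wpM2l ?bD // mulr_ge0 // sqr_ge0.
rewrite mulrDr addrACA lerD //.
rewrite /P !mulr_sumr -big_split; apply: ler_sum => i _.
by rewrite partial_lin.
Qed.

End RemainderEstimate.

Unset Implicit Arguments. Set Strict Implicit.
Theorem theorem3p3 (R : realType) (n : nat) (Omega : set 'rV[R]_n)
  (a : 'rV[R]_n -> R) (gamma : 'rV[R]_n -> 'M[R]_n) (phi : 'rV[R]_n -> R)
  (N : nat) (aj : nat -> 'rV[R]_n -> R) (w : R -> 'rV[R]_n -> R) :
  smooth_bounded_domain Omega ->
  smooth a -> (forall x, closure Omega x -> 0 < a x) ->
  smooth_mx gamma ->
  (forall x, closure Omega x -> (gamma x)^T = gamma x) ->
  (forall x, closure Omega x -> forall v : 'rV[R]_n, v != 0 ->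
     0 < (v *m gamma x *m v^T) 0 0) ->
  smooth phi ->
  (forall x, closure Omega x -> gamma_dot gamma phi phi x = a x) ->
  (1 <= N)%N ->
  (forall j, (j <= N)%N -> smooth (aj j)) ->
  (forall x, closure Omega x ->
     2 * gamma_dot gamma phi (aj 0%N) x
     + div_gamma_grad gamma phi x * aj 0%N x = 0) ->
  (forall j, (j < N)%N -> forall x, closure Omega x ->
     2 * gamma_dot gamma phi (aj j.+1) x
     + div_gamma_grad gamma phi x * aj j.+1 x
     = - div_gamma_grad gamma (aj j) x) ->
  (forall tau, 0 < tau ->
     [/\ smooth (w tau),
         (forall x, Omega x ->
            div_gamma_grad gamma (w tau) x - tau * a x * w tau x = 0) &
         (forall x, boundary Omega x ->
            w tau x = expR (Num.sqrt tau * phi x)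
                      * \sum_(j < N.+1) aj j x / Num.sqrt tau ^+ j)]) ->
  exists (C T : R), 0 < T /\
    forall tau, T <= tau ->
      (H1_norm_sq Omega
         (fun x => (expR (- (Num.sqrt tau * phi x)) * w tau x
                   - \sum_(j < N) aj j x / Num.sqrt tau ^+ j)%R)
       <= ((C / Num.sqrt tau ^+ N) ^+ 2)%R%:E)%E.
Proof.
move=> [oO _ O0 [M0 OM0] _] sa apos sgamma sym pos sphi eik N1 saj eq0 eqS Hw.
have clO x : Omega x -> closure Omega x := @subset_closure _ Omega x.
case: n => [|k] in Omega a gamma phi aj w oO O0 OM0 sa apos sgamma sym pos sphi
  eik saj eq0 eqS Hw clO *.
  (* In dimension 0 the eikonal equation reads 0 = a at a point of Omega, against a > 0. From here
     on there is a coordinate x_0 for the Poincare inequality. *)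
  case: O0 => x /clO cx; have := apos x cx.
  by rewrite -eik // /gamma_dot big_ord0 ltxx.
have OM : Omega `<=` boxed M0 by move=> x /OM0 /norm_le_boxed.
have [c c0 ellip] := uniform_ellipticity (compact_closure_boxed OM)
  (fun i j => smooth_continuous (sgamma i j)) pos.
have [d [T [mu [iso chart]]]] := @exists_lebesgue_chart R k.+1.
have sb : smooth (aj N) by exact: saj.
have [D [D0 bD]] : exists D, 0 <= D /\ forall x, boxed M0 x ->
    `|aj N x ^+ 2 + \sum_i partial i (aj N) x ^+ 2| <= D.
  apply: continuous_bounded_boxed; apply: smooth_continuous; apply: smoothD.
    exact: smooth_sqr.
  by apply: smooth_sum => i _; apply: smooth_sqr; exact: smooth_partial.
have [G [G0 hG]] : exists G, 0 <= G /\ forall x, boxed M0 x ->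
    `|div_gamma_grad gamma (aj N) x| <= G.
  apply: continuous_bounded_boxed; apply: smooth_continuous.
  by apply: smooth_sum => i _; apply: smooth_partial; exact: smooth_flux.
pose C1 := (2 * D + ((16 * M0 ^+ 2 + 2) / c) ^+ 2 * G ^+ 2 / 8) *
  fine (mu (iso @^-1` Omega)).
have C10 : 0 <= C1.
  apply: mulr_ge0; last by rewrite fine_ge0.
  by apply: addr_ge0; [rewrite mulr_ge0|rewrite divr_ge0 // mulr_ge0 // sqr_ge0].
(* The square root appears because the squared norm is bounded. The threshold 1 only ensures tau >
   0, as [C1] does not involve tau. *)
exists (Num.sqrt C1), 1; split=> // tau tau1.
have tau0 : 0 < tau by exact: lt_le_trans tau1.
have [sw eqw bw] := Hw tau tau0.
pose s := Num.sqrt tau.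
have s0 : s != 0 by rewrite gt_eqF // sqrtr_gt0.
pose u x := expR (- (s * phi x)) * w tau x - wkb_sum aj s N.+1 x.
have su : smooth u.
  rewrite (_ : u = fun x => expR (- s * phi x) * w tau x + -1 * wkb_sum aj s N.+1 x).
    apply: smoothD; apply: smoothM => //; try exact: smooth_cst.
    - by apply: smooth_expR; apply: smoothM => //; exact: smooth_cst.
    - exact: (smooth_wkb_sum saj).
  by apply/funext => x; rewrite mulN1r mulNr.
rewrite (_ : (fun x => _) = fun x => u x + s ^- N * aj N x); last first.
  by apply/funext => x; rewrite /u wkb_sumS opprD addrA subrK.
have := @H1_remainder_le R k d T mu iso chart Omega M0 oO OM gamma sgamma c D G
  phi (aj N) (div_gamma_grad gamma (aj N)) c0 (fun x Ox => ellip x (clO x Ox))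
  sphi sb.
move=> /(_ _ _ s (s ^- N) u su) H.
apply: le_trans (H _ _ _ _) _.
- by move=> x /OM /bD; apply: le_trans; exact: ler_norm.
- by move=> x /OM /hG.
- move=> x bx; rewrite /u bw // mulrA -expRD addNr expR0 mul1r.
  by rewrite subrr.
- move=> x Ox; have cx := clO x Ox.
  apply: (@transport_remainder _ _ _ sgamma _ _ _ saj _ tau0 a) => //; auto.
rewrite lee_fin [leRHS]exprMn sqr_sqrtr // /C1.
by rewrite mulrAC.
Qed.
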